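(* For all integers $t,s\ge 0$ and $m\ge 2$, there is a strong Bollobás $(t,s)$-system $(A_i,B_i)$, $1\le i\le m$, with exactly $m$ pairs such that, with $a_i=|A_i|$ and $b_i=|B_i|$, $$\sum_{i=1}^{m}\frac{\binom{b_i-t+s}{s}}{\binom{a_i+b_i-2t}{a_i-t}}=1.$$ There is also a corresponding equality system of coordinate subspaces over every field: for every field $\mathbb F$ there are a finite-dimensional $\mathbb F$-vector space with a fixed basis and exactly $m$ pairs $(A_i,B_i)$, $1\le i\le m$, of coordinate subspaces of it such that $\dim(A_i\cap B_i)\le t$ for all $i$, $\dim(A_i\cap B_j)>t+s$ for all $i\ne j$, and the displayed equality holds with $a_i=\dim A_i$, $b_i=\dim B_i$.
   Context: A strong Bollobás $(t,s)$-system is a family of pairs of finite sets $(A_i,B_i)$, $1\le i\le m$, satisfying $|A_i\cap B_i|\le t$ for all $i$ and $|A_i\cap B_j|>t+s$ for all $i\ne j$. A coordinate subspace of a vector space with a fixed basis is the span of a subset of that basis. *)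

(* Defs.v *)
From mathcomp Require Import all_boot all_order all_algebra.
Set Implicit Arguments.
Unset Strict Implicit.
Unset Printing Implicit Defensive.
Import Order.TTheory GRing.Theory Num.Theory.

Local Open Scope ring_scope.

Definition strong_bollobas (t s m : nat) (T : finType)
    (A B : 'I_m -> {set T}) : Prop :=
  (forall i, #|A i :&: B i| <= t)%N /\
  (forall i j, i != j -> t + s < #|A i :&: B j|)%N.

Definition strong_bollobas_vs (t s m : nat) (F : fieldType) (V : vectType F)
    (A B : 'I_m -> {vspace V}) : Prop :=
  (forall i, \dim (A i :&: B i) <= t)%N /\
  (forall i j, i != j -> t + s < \dim (A i :&: B j))%N.

Definition coordinate_subspace (F : fieldType) (V : vectType F) (e : seq V)
    (U : {vspace V}) : Prop :=
  exists2 X : seq V, {subset X <= e} & U = <<X>>%VS.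

(* The subtractions on nat are never truncated when a and b are the sizes (or
   dimensions) of a strong (t,s)-system with m >= 2: then a i, b i > t + s, and
   the denominators are nonzero. *)
Definition bollobas_sum (t s m : nat) (a b : 'I_m -> nat) : rat :=
  \sum_(i < m) 'C(b i - t + s, s)%:R / 'C(a i + b i - 2 * t, a i - t)%:R.

(* Main.v *)
(* Equality holds for the blow-up of the pairs ({i}, complement of {i}): take m
   disjoint blocks of size s + 1 and t further points common to all sets, let
   A_i be block i and B_i the union of the other blocks.  With N = m(s + 1),
   each of the m terms is C(N - 1, s) / C(N, s + 1) = (s + 1) / N = 1 / m.
   Coordinate subspaces are handled by sending a set S to the span of the basis
   vectors indexed by S, which turns cardinals into dimensions and preserves
   intersections. *)
Require Import Defs.
From mathcomp Require Import all_boot all_order all_algebra.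
Import GRing.Theory.

Local Open Scope ring_scope.

Section Blocks.
Variables t s m : nat.

Definition point : finType := ('I_t + 'I_m * 'I_s.+1)%type.

(** Taking an arbitrary predicate on block indices makes both members of each pair, and all their
    intersections, instances of one construction, so one cardinality count serves for all. *)
Definition blocks (P : pred 'I_m) : {set point} :=
  [set x | match x with inl _ => true | inr y => P y.1 end].

Lemma card_blocks (P : pred 'I_m) : #|blocks P| = (t + #|P| * s.+1)%N.
Proof.
rewrite -sum1_card big_sumType /=; congr addn.
  by rewrite (eq_bigl xpredT) ?sum1_card ?card_ord // => x; rewrite inE.
rewrite (eq_bigl (fun y : 'I_m * 'I_s.+1 => P y.1 && true)); last first.
  by move=> y; rewrite inE andbT.
rewrite -(pair_big P xpredT (fun _ _ => 1%N)) /=.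
by rewrite -sum_nat_const; apply: eq_bigr => i _; rewrite sum1_card card_ord.
Qed.

Lemma blocksI (P Q : pred 'I_m) :
  blocks P :&: blocks Q = blocks (predI P Q).
Proof. by apply/setP => -[x|y]; rewrite !inE. Qed.

Definition block (i : 'I_m) := blocks (pred1 i).
Definition coblock (i : 'I_m) := blocks (predC1 i).

Lemma card_block i : #|block i| = (t + s.+1)%N.
Proof. by rewrite card_blocks card1 mul1n. Qed.

Lemma card_coblock i : #|coblock i| = (t + m.-1 * s.+1)%N.
Proof. by rewrite card_blocks cardC1 card_ord. Qed.

Lemma blocks_strong_bollobas : strong_bollobas t s block coblock.
Proof.
split=> [i|i j ij]; rewrite blocksI card_blocks.
  by rewrite eq_card0 ?mul0n ?addn0 // => x; rewrite !inE andbN.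
(* For [i != j] block [i] is among the blocks other than [j], so the intersection is all of
   [block i], of size [t + s + 1], the least value allowed. *)
rewrite (@eq_card _ _ (pred1 i)) ?card1 ?mul1n ?addnS // => x.
by rewrite !inE; case: eqP => // ->.
Qed.

End Blocks.

Lemma blocks_bollobas_sum (t s m : nat) (hm : (0 < m)%N) :
  @bollobas_sum t s m (fun=> t + s.+1)%N (fun=> t + m.-1 * s.+1)%N = 1.
Proof.
rewrite /bollobas_sum sumr_const card_ord.
have -> : (t + s.+1 + (t + m.-1 * s.+1) - 2 * t = m * s.+1)%N.
  by rewrite addnACA -mulSn prednK // addnn -mul2n addKn.
have -> : (t + m.-1 * s.+1 - t + s = (m * s.+1).-1)%N.
  by rewrite addKn -{2}(prednK hm) mulSn addSn addnC.
rewrite addKn -mulrnAl -mulrnA.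
(* Multiplied by [s + 1], this is the absorption identity (s + 1) C(N, s + 1) = N C(N - 1, s) for N
   = m(s + 1). *)
have -> : ('C((m * s.+1).-1, s) * m = 'C(m * s.+1, s.+1))%N.
  apply/eqP; rewrite -(eqn_pmul2l (ltn0Sn s)) -mul_bin_diag.
  by rewrite mulnA mulnAC (mulnC s.+1).
by rewrite divff // Num.Theory.pnatr_eq0 -lt0n bin_gt0 leq_pmull.
Qed.

Section CoordinateSpan.
Variables (F : fieldType) (V : vectType F) (e : seq V) (T : finType).
Hypotheses (free_e : free e) (size_e : size e = #|T|).

(** By [size_e] every rank is a valid index of [e], so the default value 0 is never reached. *)
Let basis_vec (x : T) : V := e`_(enum_rank x).

Definition coord_span (S : {set T}) : {vspace V} :=
  <<[seq basis_vec x | x in S]>>%VS.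

Lemma mem_basis_vec x : basis_vec x \in e.
Proof. by rewrite mem_nth // size_e. Qed.

Lemma basis_vec_inj : injective basis_vec.
Proof.
move=> x y /eqP; rewrite nth_uniq ?size_e ?free_uniq // => /eqP xy.
exact/enum_rank_inj/val_inj.
Qed.

Lemma coord_span_coordinate S : coordinate_subspace e (coord_span S).
Proof.
exists [seq basis_vec x | x in S] => // _ /imageP [x _ ->].
exact: mem_basis_vec.
Qed.

Lemma dim_coord_span S : \dim (coord_span S) = #|S|.
Proof.
set X := [seq basis_vec x | x in S].
have uniq_X : uniq X by rewrite map_inj_uniq ?enum_uniq //; apply: basis_vec_inj.
(* Up to order, [X] is a subsequence of the free sequence [e], hence free. *)
have perm_X : perm_eq X [seq v <- e | v \in X].
  apply: uniq_perm => // [|v]; first by rewrite filter_uniq // free_uniq.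
  rewrite mem_filter.
  by apply/idP/andP => [vX|[]//]; split=> //; case/imageP: vX => x _ ->;
    apply: mem_basis_vec.
rewrite -(size_image basis_vec); apply/eqP.
by rewrite -/(free X) (perm_free perm_X) filter_free.
Qed.

Lemma coord_spanU S1 S2 :
  (coord_span S1 + coord_span S2)%VS = coord_span (S1 :|: S2).
Proof.
rewrite -span_cat; apply: eq_span => v; rewrite mem_cat.
apply/orP/imageP => [[] /imageP [x xS ->]|[x /setUP [] xS ->]].
- by exists x; rewrite // inE xS.
- by exists x; rewrite // inE xS orbT.
- by left; apply: image_f.
- by right; apply: image_f.
Qed.

(** Only the dimension of the intersection matters. Sums of coordinate spans are easy to identify,
    and the dimension formula for sum and intersection then matches inclusion-exclusion for
    cardinals. *)
Lemma dim_coord_spanI S1 S2 :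
  \dim (coord_span S1 :&: coord_span S2) = #|S1 :&: S2|.
Proof.
apply: (@addnI #|S1 :|: S2|); rewrite cardsUI -dim_coord_span -coord_spanU.
by rewrite dimv_sum_cap !dim_coord_span.
Qed.

End CoordinateSpan.

Theorem proposition5p2 (t s m : nat) (hm : (2 <= m)%N) :
  (exists (T : finType) (A B : 'I_m -> {set T}),
      strong_bollobas t s A B /\
      bollobas_sum t s (fun i => #|A i|) (fun i => #|B i|) = 1) /\
  (forall F : fieldType,
    exists (V : vectType F) (e : seq V) (A B : 'I_m -> {vspace V}),
      [/\ basis_of fullv e,
          (forall i, coordinate_subspace e (A i)),
          (forall i, coordinate_subspace e (B i)),
          strong_bollobas_vs t s A B
        & bollobas_sum t s (fun i => \dim (A i)) (fun i => \dim (B i)) = 1]).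
Proof.
(* Asking only for pointwise equality lets this serve both for cardinals and for dimensions. *)
have hsum (a b : 'I_m -> nat) :
    (forall i, a i = #|block t s m i|) -> (forall i, b i = #|coblock t s m i|) ->
  bollobas_sum t s a b = 1.
  move=> ha hb; rewrite -(@blocks_bollobas_sum t s m (ltnW hm)).
  by apply: eq_bigr => i _; rewrite ha hb card_block card_coblock.
have [cap_le cap_gt] := blocks_strong_bollobas t s m.
split=> [|F].
  exists (point t s m), (block t s m), (coblock t s m).
  by split; [split | apply: hsum].
(* Any space of dimension [#|T|] with any basis would do. *)
pose T := point t s m; pose V : vectType F := 'rV[F]_#|T|.
pose e : seq V := vbasis fullv.
have basis_e : basis_of fullv e := vbasisP _.
have free_e := basis_free basis_e.
have size_e : size e = #|T| by rewrite size_tuple dimvf dim_matrix mul1r.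
exists V, e, (fun i => coord_span F V e T (block t s m i)),
  (fun i => coord_span F V e T (coblock t s m i)); split=> //.
- by move=> i; apply: coord_span_coordinate.
- by move=> i; apply: coord_span_coordinate.
- by split=> [i|i j ij]; rewrite dim_coord_spanI //; apply: cap_gt.
- by apply: hsum => i; rewrite dim_coord_span.
Qed.
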